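(* Let $\gamma=0$ and assume that the eigenvalues of $A$ can be anywhere in the interval $[0,\infty)$. Then the optimal relaxation parameter $\theta^\star_{\mathrm{DN}_3}$ of the Dirichlet-Neumann algorithm DN$_3$ is identical to the optimal relaxation parameter $\theta^\star_{\mathrm{ND}_2}$ of the Neumann-Dirichlet algorithm ND$_2$ (for the same $\nu$, $T$, $\alpha$).
   Context: Let $\nu>0$, $T>0$, $0<\alpha<T$, $\Omega_1=(0,\alpha)$, $\Omega_2=(\alpha,T)$. For an eigenvalue $d\ge 0$ write (S) for the system $\dot z+dz-\nu^{-1}\mu=0$, $\dot\mu-z-d\mu=0$. Take $\gamma=0$. Algorithm DN$_3$: given $f^0\in\mathbb{R}$, for $k\ge1$ solve (S) for $(z_1^k,\mu_1^k)$ in $\Omega_1$ with $z_1^k(0)=0$, $\mu_1^k(\alpha)=f^{k-1}$; solve (S) for $(z_2^k,\mu_2^k)$ in $\Omega_2$ with $\dot\mu_2^k(\alpha)=\dot\mu_1^k(\alpha)$, $\mu_2^k(T)=0$; set $f^k=(1-\theta)f^{k-1}+\theta\mu_2^k(\alpha)$. Algorithm ND$_2$: given $f^0\in\mathbb{R}$, for $k\ge1$ solve (S) for $(z_1^k,\mu_1^k)$ in $\Omega_1$ with $z_1^k(0)=0$, $\dot z_1^k(\alpha)=f^{k-1}$; solve (S) for $(z_2^k,\mu_2^k)$ in $\Omega_2$ with $z_2^k(\alpha)=z_1^k(\alpha)$, $\mu_2^k(T)=0$; set $f^k=(1-\theta)f^{k-1}+\theta\dot z_2^k(\alpha)$. For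 each algorithm, by linearity $f^k=r(\theta,d)f^{k-1}$ for a real number $r(\theta,d)$ (depending on the algorithm and on $\theta,d,\nu,T,\alpha$). The optimal relaxation parameter of the algorithm is the minimizer over $\theta\in(0,1)$ of $\sup_{d\in[0,\infty)}|r(\theta,d)|$. *)

(* Defs.v *)
(* Stdlib real numbers, with Coquelicot for suprema in the extended reals. *)
From Stdlib Require Import Reals.
From Coquelicot Require Import Coquelicot.
Open Scope R_scope.

(* (z, mu) solves, with derivatives (dz, dmu),
     z' + d z - mu / nu = 0,   mu' - z - d mu = 0
   up to the end points of [a, b].  [D_in] is differentiability relative to
   [a, b]; hence [dz a], [dz b], [dmu a], [dmu b] are one-sided derivatives, and
   values outside [a, b] play no role. *)
Definition solves_S (nu d a b : R) (z dz mu dmu : R -> R) : Prop :=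
  forall t, a <= t <= b ->
    D_in z dz (fun s => a <= s <= b) t /\
    D_in mu dmu (fun s => a <= s <= b) t /\
    dz t + d * z t - / nu * mu t = 0 /\
    dmu t - z t - d * mu t = 0.

Definition DN3_step (nu T alpha theta d f f' : R) : Prop :=
  exists z1 dz1 mu1 dmu1 z2 dz2 mu2 dmu2 : R -> R,
    (solves_S nu d 0 alpha z1 dz1 mu1 dmu1 /\ z1 0 = 0 /\ mu1 alpha = f) /\
    (solves_S nu d alpha T z2 dz2 mu2 dmu2 /\
     dmu2 alpha = dmu1 alpha /\ mu2 T = 0) /\
    f' = (1 - theta) * f + theta * mu2 alpha.

Definition ND2_step (nu T alpha theta d f f' : R) : Prop :=
  exists z1 dz1 mu1 dmu1 z2 dz2 mu2 dmu2 : R -> R,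
    (solves_S nu d 0 alpha z1 dz1 mu1 dmu1 /\ z1 0 = 0 /\ dz1 alpha = f) /\
    (solves_S nu d alpha T z2 dz2 mu2 dmu2 /\
     z2 alpha = z1 alpha /\ mu2 T = 0) /\
    f' = (1 - theta) * f + theta * dz2 alpha.

Definition iterates (step : R -> R -> Prop) (f : nat -> R) : Prop :=
  forall k, step (f k) (f (S k)).

(* The first clause makes [r] unique: without it, an algorithm that cannot be run
   would have every real number as its factor. *)
Definition is_factor (step : R -> R -> Prop) (r : R) : Prop :=
  (forall f0, exists f, f O = f0 /\ iterates step f) /\
  (forall f, iterates step f -> forall k, f (S k) = r * f k).

Definition sup_factor (r : R -> R -> R) (theta : R) : Rbar :=
  Lub_Rbar (fun x => exists d, 0 <= d /\ x = Rabs (r theta d)).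

Definition is_minimizer (r : R -> R -> R) (theta : R) : Prop :=
  0 < theta < 1 /\
  forall theta', 0 < theta' < 1 ->
    Rbar_le (sup_factor r theta) (sup_factor r theta').

Definition is_optimal_relaxation (r : R -> R -> R) (theta : R) : Prop :=
  unique (is_minimizer r) theta.

(* Main.v *)
Require Import Defs.
From Stdlib Require Import Reals.
From Coquelicot Require Import Coquelicot.
From Stdlib Require Import Lra.
Open Scope R_scope.

(** Put [sigma = sqrt (d^2 + 1/nu)]. Solving (S) explicitly gives, for both
    algorithms, [r theta d = 1 - theta (1 + rho d)] with
      [rho d = tanh (sigma y) (sigma tanh (sigma x) + d) / (sigma + d tanh (sigma x))],
    where [(x, y)] is [(alpha, T - alpha)] for DN3 and [(T - alpha, alpha)] for
    ND2. The value [rho 0 = tanh (sigma x) tanh (sigma y)] is symmetric in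
    [(x, y)]; it is the minimum of [rho], whereas the supremum of [rho] is its
    limit [1] at infinity. The best [theta] equilibrates the two extreme values
    of [r], i.e. [1 - theta (1 + rho 0) = 2 theta - 1], so that
    [theta = 2 / (3 + rho 0)] in both cases. *)

(** * Linear equations on a closed interval *)

(* Composing [f] with the retraction of [R] onto [a, b] turns differentiability
   relative to [a, b] with zero derivative into two-sided differentiability. *)
Lemma D_in_zero_constant (f df : R -> R) (a b : R) :
  a <= b ->
  (forall t, a <= t <= b -> D_in f df (fun s => a <= s <= b) t /\ df t = 0) ->
  f b = f a.
Proof.
intros hab H.
pose (clamp := fun x => Rmax a (Rmin b x)).
assert (clamp_in : forall x, a <= clamp x <= b).
{ intros x; unfold clamp, Rmax, Rmin.
  destruct (Rle_dec b x); destruct (Rle_dec a _); lra. }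
assert (clamp_id : forall x, a <= x <= b -> clamp x = x).
{ intros x hx; unfold clamp, Rmax, Rmin.
  destruct (Rle_dec b x); destruct (Rle_dec a _); lra. }
assert (clamp_le : forall t x, a <= t <= b ->
  Rabs (clamp x - t) <= Rabs (x - t)).
{ intros t x ht; unfold clamp, Rmax, Rmin.
  destruct (Rle_dec b x); destruct (Rle_dec a _); unfold Rabs;
    repeat destruct (Rcase_abs _); lra. }
assert (Hd : forall t, a <= t <= b ->
  derivable_pt_lim (fun x => f (clamp x)) t 0).
{ intros t ht eps heps.
  destruct (H t ht) as [hD h0].
  destruct (hD eps heps) as [del [hdel hlim]].
  exists (mkposreal del hdel); intros h hh hhd; simpl in hhd.
  rewrite (clamp_id t ht), Rminus_0_r.
  assert (hle := clamp_le t (t + h) ht).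
  replace (t + h - t) with h in hle by ring.
  (* [D_in] only controls quotients at points other than [t], so the case where the retraction falls
     back on [t] is separate; there the quotient is 0. *)
  destruct (Req_dec (clamp (t + h)) t) as [e | ne].
  { rewrite e; replace ((f t - f t) / h) with 0 by (field; exact hh).
    rewrite Rabs_R0; exact heps. }
  assert (hne : clamp (t + h) - t <> 0) by lra.
  assert (hq : Rabs ((f (clamp (t + h)) - f t) / (clamp (t + h) - t)) < eps).
  { assert (hq := hlim (clamp (t + h))).
    simpl in hq; unfold Rdist in hq; rewrite h0, Rminus_0_r in hq.
    apply hq; repeat split; try apply clamp_in; try lra; auto. }
  (* The second factor has absolute value at most 1, as the retraction does not increase distances
     to [t]. *)
  replace ((f (clamp (t + h)) - f t) / h) with
    ((f (clamp (t + h)) - f t) / (clamp (t + h) - t)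
       * ((clamp (t + h) - t) / h)) by (field; auto).
  rewrite Rabs_mult.
  apply Rle_lt_trans with (2 := hq).
  rewrite <- (Rmult_1_r (Rabs _)) at 2.
  apply Rmult_le_compat_l; [apply Rabs_pos|].
  rewrite Rabs_div by exact hh.
  apply Rmult_le_reg_r with (Rabs h); [apply Rabs_pos_lt, hh|].
  unfold Rdiv; rewrite Rmult_assoc, Rinv_l by (apply Rabs_no_R0, hh); lra. }
destruct hab as [hab | ->]; [|reflexivity].
destruct (MVT_cor2 _ (fun _ => 0) a b hab Hd) as [c [hc _]].
rewrite !clamp_id in hc by lra; lra.
Qed.

Lemma is_derive_D_in (f df : R -> R) (D : R -> Prop) (t : R) :
  is_derive f t (df t) -> D_in f df D t.
Proof.
intros H; apply is_derive_Reals in H.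
apply derivable_pt_lim_D_in in H.
eapply limit1_imp; [|exact H].
intros x [_ hx]; split; [exact I | exact hx].
Qed.

(** Integrating factor: the derivative of [p t * exp (- c * t)] vanishes. *)
Lemma D_in_exponential (p dp : R -> R) (c a b : R) :
  a <= b ->
  (forall t, a <= t <= b ->
     D_in p dp (fun s => a <= s <= b) t /\ dp t = c * p t) ->
  p b = p a * exp (c * (b - a)).
Proof.
intros hab H.
assert (hc : p b * exp (- c * b) = p a * exp (- c * a)).
{ apply (D_in_zero_constant (fun t => p t * exp (- c * t))
    (fun t => dp t * exp (- c * t) + p t * (- c * exp (- c * t))) a b hab).
  intros t ht; destruct (H t ht) as [h1 h2]; split.
  - apply (Dmult _ _ (fun t => - c * exp (- c * t)) p (fun t => exp (- c * t)));
      [exact h1|].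
    apply is_derive_D_in; auto_derive; [exact I | ring].
  - rewrite h2; ring. }
replace (c * (b - a)) with (- c * a + c * b) by ring.
rewrite exp_plus, <- Rmult_assoc, <- hc, Rmult_assoc, <- exp_plus.
replace (- c * b + c * b) with 0 by ring.
rewrite exp_0; ring.
Qed.

(** * The flow of (S) *)

Definition sigma (nu d : R) : R := sqrt (d * d + / nu).

Lemma sigma_sqr (nu d : R) : 0 < nu -> sigma nu d * sigma nu d = d * d + / nu.
Proof.
intros hnu; apply sqrt_sqrt.
assert (h := Rinv_0_lt_compat nu hnu); nra.
Qed.

Lemma sigma_pos (nu d : R) : 0 < nu -> 0 < sigma nu d.
Proof.
intros hnu; apply sqrt_lt_R0.
assert (h := Rinv_0_lt_compat nu hnu); nra.
Qed.

Lemma sigma_ge (nu d : R) : 0 < nu -> d <= sigma nu d.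
Proof.
intros hnu.
assert (h := Rinv_0_lt_compat nu hnu).
assert (h1 := sigma_sqr nu d hnu); assert (h2 := sigma_pos nu d hnu); nra.
Qed.

Lemma sigma_ge_0 (nu d : R) : sigma nu 0 <= sigma nu d.
Proof. apply sqrt_le_1_alt; nra. Qed.

(* [(1, d + sigma)] and [(1, d - sigma)] are left eigenvectors of the matrix of
   (S), for the eigenvalues [sigma] and [- sigma]. *)
Lemma solves_S_flow (nu d a b : R) (z dz mu dmu : R -> R) :
  0 < nu -> a <= b -> solves_S nu d a b z dz mu dmu ->
  let s := sigma nu d in
  let h := s * (b - a) in
  s * z b = z a * (s * cosh h - d * sinh h) + mu a * (/ nu * sinh h) /\
  s * mu b = z a * sinh h + mu a * (s * cosh h + d * sinh h).
Proof.
intros hnu hab H s h.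
assert (hs : s * s = d * d + / nu) by (apply sigma_sqr, hnu).
assert (hs0 : 0 < s) by (apply sigma_pos, hnu).
(* Pairing with a left eigenvector decouples the system; [c] stands for both [s] and [- s]. *)
assert (E : forall c, c * c = s * s ->
  z b + (c + d) * mu b = (z a + (c + d) * mu a) * exp (c * (b - a))).
{ intros c hc.
  apply (D_in_exponential (fun t => z t + (c + d) * mu t)
           (fun t => dz t + (c + d) * dmu t) c a b hab).
  intros t ht; destruct (H t ht) as (h1 & h2 & h3 & h4); split.
  - apply Dadd; [exact h1|].
    apply (Dmult_const _ mu dmu); exact h2.
  - replace (dz t) with (/ nu * mu t - d * z t) by lra.
    replace (dmu t) with (z t + d * mu t) by lra.
    replace (/ nu) with (c * c - d * d) by lra; ring. }
assert (E1 := E s eq_refl).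
assert (E2 := E (- s) ltac:(ring)).
replace (- s * (b - a)) with (- h) in E2 by (unfold h; ring).
fold h in E1.
replace (/ nu) with (s * s - d * d) by lra.
unfold cosh, sinh.
(* The difference of [E1] and [E2] eliminates [z b]; weighting them by [s - d] and [s + d]
   eliminates [mu b]. *)
assert (hmu : 2 * (s * mu b) =
  (z a + (s + d) * mu a) * exp h - (z a + (- s + d) * mu a) * exp (- h))
  by (rewrite <- E1, <- E2; ring).
assert (hz : 2 * (s * z b) =
  (s - d) * ((z a + (s + d) * mu a) * exp h)
  + (s + d) * ((z a + (- s + d) * mu a) * exp (- h)))
  by (rewrite <- E1, <- E2; ring).
split; lra.
Qed.

(** The matrix M of (S) satisfies M^2 = s^2 I, so its exponential is exp(tM) = cosh(st) I +
    (sinh(st)/s) M; the witnesses are this flow applied to the initial data. *)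
Lemma solves_S_exists (nu d a b za mua : R) :
  0 < nu ->
  exists z dz mu dmu, solves_S nu d a b z dz mu dmu /\ z a = za /\ mu a = mua.
Proof.
intros hnu.
assert (hs : sigma nu d * sigma nu d = d * d + / nu) by (apply sigma_sqr, hnu).
assert (hs0 : 0 < sigma nu d) by (apply sigma_pos, hnu).
set (s := sigma nu d) in *.
pose (z := fun t => za * cosh (s * (t - a))
                    + (/ nu * mua - d * za) / s * sinh (s * (t - a))).
pose (mu := fun t => mua * cosh (s * (t - a))
                    + (za + d * mua) / s * sinh (s * (t - a))).
exists z, (fun t => / nu * mu t - d * z t), mu, (fun t => z t + d * mu t).
assert (hnu' : / nu = s * s - d * d) by lra.
repeat split; try ring.
- apply is_derive_D_in; rewrite hnu'; unfold z, mu, cosh, sinh.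
  rewrite hnu'.
  auto_derive; [exact I|].
  change (t + - a) with (t - a); field; lra.
- apply is_derive_D_in; unfold z, mu, cosh, sinh.
  rewrite hnu'.
  auto_derive; [exact I|].
  change (t + - a) with (t - a); field; lra.
- unfold z; rewrite Rminus_diag, Rmult_0_r, cosh_0, sinh_0; ring.
- unfold mu; rewrite Rminus_diag, Rmult_0_r, cosh_0, sinh_0; ring.
Qed.

(** * Convergence factors *)

Lemma cosh_pos (x : R) : 0 < cosh x.
Proof.
unfold cosh; assert (h1 := exp_pos x); assert (h2 := exp_pos (- x)); lra.
Qed.

Lemma tanh_exp (x : R) : tanh x = 1 - 2 / (exp (2 * x) + 1).
Proof.
assert (h := exp_pos x).
unfold tanh, cosh, sinh; rewrite exp_Ropp.
replace (2 * x) with (x + x) by ring; rewrite exp_plus.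
field; nra.
Qed.

Lemma tanh_lt_1 (x : R) : tanh x < 1.
Proof.
rewrite tanh_exp; assert (h := exp_pos (2 * x)).
assert (0 < 2 / (exp (2 * x) + 1)) by (apply Rdiv_lt_0_compat; lra); lra.
Qed.

Lemma tanh_increasing (x y : R) : x <= y -> tanh x <= tanh y.
Proof.
intros hxy; rewrite !tanh_exp.
assert (h := exp_pos (2 * x)).
assert (h' : exp (2 * x) <= exp (2 * y)).
{ destruct hxy as [hlt | ->]; [left; apply exp_increasing; lra | lra]. }
assert (/ (exp (2 * y) + 1) <= / (exp (2 * x) + 1))
  by (apply Rinv_le_contravar; lra).
unfold Rdiv; lra.
Qed.

Lemma tanh_nonneg (x : R) : 0 <= x -> 0 <= tanh x.
Proof.
intros hx; replace 0 with (tanh 0); [apply tanh_increasing, hx|].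
unfold tanh; rewrite sinh_0; unfold Rdiv; ring.
Qed.

(** Follows from exp(2x) > 1 + 2x; it gives a rate for the limit 1 at infinity. *)
Lemma tanh_ge (x : R) : 0 < x -> 1 - / x <= tanh x.
Proof.
intros hx; rewrite tanh_exp.
assert (h := exp_ineq1 (2 * x) ltac:(lra)).
assert (/ (exp (2 * x) + 1) <= / (2 * x)) by (apply Rinv_le_contravar; lra).
rewrite Rinv_mult in H; unfold Rdiv; lra.
Qed.

(** Since d < s when [nu] is positive, the quotient without the factor [tanh (s * y)] is tanh(s x +
    artanh(d/s)). *)
Definition rho (nu x y d : R) : R :=
  let s := sigma nu d in
  tanh (s * y) * (s * tanh (s * x) + d) / (s + d * tanh (s * x)).

Definition factor (nu x y theta d : R) : R := 1 - theta * (1 + rho nu x y d).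

Lemma rho_cosh_sinh (nu x y d : R) :
  0 < nu -> 0 < x -> 0 <= d ->
  let s := sigma nu d in
  0 < s * cosh (s * x) + d * sinh (s * x) /\
  rho nu x y d =
    sinh (s * y) * (s * sinh (s * x) + d * cosh (s * x))
    / (cosh (s * y) * (s * cosh (s * x) + d * sinh (s * x))).
Proof.
intros hnu hx hd s.
assert (hs : 0 < s) by (apply sigma_pos, hnu).
assert (hcx := cosh_pos (s * x)); assert (hcy := cosh_pos (s * y)).
assert (ht : 0 <= tanh (s * x)) by (apply tanh_nonneg; nra).
assert (hsx : sinh (s * x) = tanh (s * x) * cosh (s * x))
  by (unfold tanh; field; lra).
assert (hp : 0 < s + d * tanh (s * x)) by nra.
split.
- rewrite hsx; nra.
- unfold rho; fold s.
  replace (tanh (s * y)) with (sinh (s * y) / cosh (s * y)) by reflexivity.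
  rewrite hsx; field; repeat split; nra.
Qed.

(** One direction of the equivalence makes the geometric sequence a run of the algorithm; the other
    forces every run to be geometric. *)
Lemma is_factor_of_step (step : R -> R -> Prop) (r : R) :
  (forall f f', step f f' <-> f' = r * f) -> is_factor step r.
Proof.
intros H; split.
- intros f0; exists (fun k => r ^ k * f0); split; [simpl; ring|].
  intros k; apply H; simpl; ring.
- intros f hf k; apply H, hf.
Qed.

(** The first solve turns f into mu1'(alpha) = s f tanh(s alpha + artanh(d/s)); the second gives
    mu2(alpha) = - tanh(s (T - alpha)) mu1'(alpha) / s. *)
Lemma DN3_factor (nu T alpha theta d : R) :
  0 < nu -> 0 < alpha < T -> 0 <= d ->
  is_factor (DN3_step nu T alpha theta d)
    (factor nu alpha (T - alpha) theta d).
Proof.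
intros hnu halpha hd; apply is_factor_of_step; intros f f'.
destruct (rho_cosh_sinh nu alpha (T - alpha) d hnu ltac:(lra) hd) as [hp hrho].
unfold factor; rewrite hrho; clear hrho.
assert (hs : 0 < sigma nu d) by (apply sigma_pos, hnu).
assert (hss : sigma nu d * sigma nu d = d * d + / nu) by (apply sigma_sqr, hnu).
assert (hcy := cosh_pos (sigma nu d * (T - alpha))).
split.
- intros (z1 & dz1 & mu1 & dmu1 & z2 & dz2 & mu2 & dmu2
          & (h1 & hz & hmu) & (h2 & hdm & hmT) & ->).
  destruct (solves_S_flow nu d 0 alpha _ _ _ _ hnu ltac:(lra) h1) as [e1 e2].
  destruct (solves_S_flow nu d alpha T _ _ _ _ hnu ltac:(lra) h2) as [_ e3].
  destruct (h1 alpha ltac:(lra)) as (_ & _ & _ & e4).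
  destruct (h2 alpha ltac:(lra)) as (_ & _ & _ & e5).
  rewrite Rminus_0_r in e1, e2.
  rewrite hz in e1, e2; rewrite hmT in e3; rewrite hmu in e2, e4.
  revert hp hs hss hcy e1 e2 e3.
  generalize (sigma nu d); intros s.
  generalize (cosh (s * alpha)) (sinh (s * alpha))
    (cosh (s * (T - alpha))) (sinh (s * (T - alpha))).
  intros ca sa cb sb hp hs hss hcb e1 e2 e3.
  (* The initial value of [mu1] is recovered from the Dirichlet condition at [alpha]. *)
  assert (em : mu1 0 = s * f / (s * ca + d * sa)).
  { apply Rmult_eq_reg_r with (s * ca + d * sa); [|lra].
    rewrite e2; field; lra. }
  assert (ez1 : z1 alpha = (s * s - d * d) * sa * f / (s * ca + d * sa)).
  { apply Rmult_eq_reg_l with s; [|lra].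
    rewrite e1, em; replace (/ nu) with (s * s - d * d) by lra; field; lra. }
  (* By (S), equality of the derivatives of [mu] at [alpha] means equality of z + d mu. *)
  assert (ez2 : z2 alpha = z1 alpha + d * f - d * mu2 alpha) by lra.
  assert (emu : mu2 alpha = - (z1 alpha + d * f) * sb / (s * cb)).
  { apply Rmult_eq_reg_r with (s * cb); [|nra].
    rewrite ez2 in e3; field_simplify; nra. }
  rewrite emu, ez1; field; lra.
- intros ->.
  set (s := sigma nu d) in *.
  set (h := s * alpha) in *; set (k := s * (T - alpha)) in *.
  (* Shooting: the initial value of [mu1] is the one for which [mu1 alpha = f]. *)
  destruct (solves_S_exists nu d 0 alpha 0
              (s * f / (s * cosh h + d * sinh h)) hnu)
    as (z1 & dz1 & mu1 & dmu1 & h1 & hz1 & hm1).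
  destruct (solves_S_flow nu d 0 alpha _ _ _ _ hnu ltac:(lra) h1) as [e1 e2].
  rewrite Rminus_0_r in e1, e2; fold s in e1, e2; fold h in e1, e2.
  rewrite hz1, hm1 in e1, e2.
  (* This is - rho f, the value of [mu2 alpha] forced by [mu2 T = 0]; the matching [z2 alpha] below
     makes the derivatives of [mu] agree. *)
  set (m2 := - (sinh k * (s * sinh h + d * cosh h)
                / (cosh k * (s * cosh h + d * sinh h))) * f).
  destruct (solves_S_exists nu d alpha T (dmu1 alpha - d * m2) m2 hnu)
    as (z2 & dz2 & mu2 & dmu2 & h2 & hz2 & hm2).
  destruct (solves_S_flow nu d alpha T _ _ _ _ hnu ltac:(lra) h2) as [_ e3].
  fold s in e3; fold k in e3; rewrite hz2, hm2 in e3.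
  destruct (h1 alpha ltac:(lra)) as (_ & _ & _ & e4).
  destruct (h2 alpha ltac:(lra)) as (_ & _ & _ & e5).
  assert (emu : mu1 alpha = f).
  { apply Rmult_eq_reg_l with s; [|lra]. rewrite e2; field; lra. }
  assert (ez1 : z1 alpha
    = (s * s - d * d) * sinh h * f / (s * cosh h + d * sinh h)).
  { apply Rmult_eq_reg_l with s; [|lra].
    rewrite e1; replace (/ nu) with (s * s - d * d) by lra; field; lra. }
  exists z1, dz1, mu1, dmu1, z2, dz2, mu2, dmu2.
  repeat split; auto; try apply h1; try apply h2; auto.
  + rewrite hm2, hz2 in e5; lra.
  + apply Rmult_eq_reg_l with s; [|lra].
    rewrite e3; replace (dmu1 alpha) with (z1 alpha + d * f)
      by (rewrite emu in e4; lra).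
    rewrite ez1; unfold m2; field; lra.
  + rewrite hm2; unfold m2; field; lra.
Qed.

(** The intervals exchange roles: the Neumann solve on the first gives z1(alpha) = tanh(s alpha) f /
    s, and the Dirichlet solve on the second contributes the quotient with T - alpha. *)
Lemma ND2_factor (nu T alpha theta d : R) :
  0 < nu -> 0 < alpha < T -> 0 <= d ->
  is_factor (ND2_step nu T alpha theta d)
    (factor nu (T - alpha) alpha theta d).
Proof.
intros hnu halpha hd; apply is_factor_of_step; intros f f'.
destruct (rho_cosh_sinh nu (T - alpha) alpha d hnu ltac:(lra) hd) as [hp hrho].
unfold factor; rewrite hrho; clear hrho.
assert (hs : 0 < sigma nu d) by (apply sigma_pos, hnu).
assert (hss : sigma nu d * sigma nu d = d * d + / nu) by (apply sigma_sqr, hnu).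
assert (hca := cosh_pos (sigma nu d * alpha)).
split.
- intros (z1 & dz1 & mu1 & dmu1 & z2 & dz2 & mu2 & dmu2
          & (h1 & hz & hdz) & (h2 & hz2 & hmT) & ->).
  destruct (solves_S_flow nu d 0 alpha _ _ _ _ hnu ltac:(lra) h1) as [e1 e2].
  destruct (solves_S_flow nu d alpha T _ _ _ _ hnu ltac:(lra) h2) as [_ e3].
  destruct (h1 alpha ltac:(lra)) as (_ & _ & e4 & _).
  destruct (h2 alpha ltac:(lra)) as (_ & _ & e5 & _).
  rewrite Rminus_0_r in e1, e2.
  rewrite hz in e1, e2; rewrite hmT in e3; rewrite hdz in e4.
  revert hp hs hss hca e1 e2 e3.
  generalize (sigma nu d); intros s.
  generalize (cosh (s * alpha)) (sinh (s * alpha))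
    (cosh (s * (T - alpha))) (sinh (s * (T - alpha))).
  intros ca sa cb sb hp hs hss hca e1 e2 e3.
  (* In f = mu1(alpha)/nu - d z1(alpha) the sinh terms cancel, leaving only cosh. *)
  assert (em : / nu * mu1 0 = f / ca).
  { apply Rmult_eq_reg_r with (s * ca); [|nra].
    replace (f / ca * (s * ca)) with (s * f) by (field; lra).
    replace f with (/ nu * mu1 alpha - d * z1 alpha) by lra.
    replace (s * (/ nu * mu1 alpha - d * z1 alpha)) with
      (/ nu * (s * mu1 alpha) - d * (s * z1 alpha)) by ring.
    rewrite e1, e2; ring. }
  assert (ez1 : z1 alpha = sa * f / (s * ca)).
  { apply Rmult_eq_reg_l with s; [|lra].
    rewrite e1; replace (mu1 0 * (/ nu * sa)) with (/ nu * mu1 0 * sa) by ring.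
    rewrite em; field; lra. }
  assert (emu : mu2 alpha = - z1 alpha * sb / (s * cb + d * sb)).
  { apply Rmult_eq_reg_r with (s * cb + d * sb); [|lra].
    rewrite hz2 in e3.
    replace (- z1 alpha * sb / (s * cb + d * sb) * (s * cb + d * sb))
      with (- z1 alpha * sb) by (field; lra); lra. }
  replace (dz2 alpha) with ((s * s - d * d) * mu2 alpha - d * z1 alpha)
    by (replace (s * s - d * d) with (/ nu) by lra; rewrite <- hz2; lra).
  rewrite emu, ez1; field; lra.
- intros ->.
  set (s := sigma nu d) in *.
  set (h := s * alpha) in *; set (k := s * (T - alpha)) in *.
  destruct (solves_S_exists nu d 0 alpha 0 (nu * f / cosh h) hnu)
    as (z1 & dz1 & mu1 & dmu1 & h1 & hz1 & hm1).
  destruct (solves_S_flow nu d 0 alpha _ _ _ _ hnu ltac:(lra) h1) as [e1 e2].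
  rewrite Rminus_0_r in e1, e2; fold s in e1, e2; fold h in e1, e2.
  rewrite hz1, hm1 in e1, e2.
  (* The initial value of [mu2] is the one for which [mu2 T = 0]. *)
  destruct (solves_S_exists nu d alpha T (z1 alpha)
              (- z1 alpha * sinh k / (s * cosh k + d * sinh k)) hnu)
    as (z2 & dz2 & mu2 & dmu2 & h2 & hz2 & hm2).
  destruct (solves_S_flow nu d alpha T _ _ _ _ hnu ltac:(lra) h2) as [_ e3].
  fold s in e3; fold k in e3; rewrite hz2, hm2 in e3.
  destruct (h1 alpha ltac:(lra)) as (_ & _ & e4 & _).
  destruct (h2 alpha ltac:(lra)) as (_ & _ & e5 & _).
  assert (ez1 : z1 alpha = sinh h * f / (s * cosh h)).
  { apply Rmult_eq_reg_l with s; [|lra]. rewrite e1; field; lra. }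
  exists z1, dz1, mu1, dmu1, z2, dz2, mu2, dmu2.
  repeat split; auto; try apply h1; try apply h2; auto.
  + replace (dz1 alpha) with (/ nu * mu1 alpha - d * z1 alpha) by lra.
    replace (mu1 alpha) with
      (nu * f / cosh h * (s * cosh h + d * sinh h) / s)
      by (apply Rmult_eq_reg_l with s; [rewrite e2; field; lra | lra]).
    rewrite ez1; field; lra.
  + apply Rmult_eq_reg_l with s; [|lra].
    rewrite e3; field; lra.
  + replace (dz2 alpha) with ((s * s - d * d) * mu2 alpha - d * z2 alpha)
      by (replace (s * s - d * d) with (/ nu) by lra; lra).
    rewrite hm2, hz2, ez1; field; lra.
Qed.

(** * Optimization *)

(** With u = tanh(s x), the quotient lies between u and 1 because d (1 - u^2) and (s - d)(1 - u) are
    nonnegative. *)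
Lemma rho_bounds (nu x y d : R) :
  0 < nu -> 0 < x -> 0 < y -> 0 <= d ->
  tanh (sigma nu d * x) * tanh (sigma nu d * y) <= rho nu x y d <= 1.
Proof.
intros hnu hx hy hd.
assert (hs := sigma_pos nu d hnu); assert (hsd := sigma_ge nu d hnu).
unfold rho; set (s := sigma nu d) in *; cbv zeta.
assert (hx0 : 0 <= tanh (s * x)) by (apply tanh_nonneg; nra).
assert (hy0 : 0 <= tanh (s * y)) by (apply tanh_nonneg; nra).
assert (hx1 := tanh_lt_1 (s * x)); assert (hy1 := tanh_lt_1 (s * y)).
revert hx0 hy0 hx1 hy1.
generalize (tanh (s * x)) (tanh (s * y)); intros u v hx0 hy0 hx1 hy1.
assert (hp : 0 < s + d * u) by nra.
assert (h1 : u <= (s * u + d) / (s + d * u)).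
{ apply Rle_div_r; [exact hp|].
  assert (0 <= d * (1 - u * u)) by (apply Rmult_le_pos; nra); nra. }
assert (h2 : (s * u + d) / (s + d * u) <= 1) by (apply Rle_div_l; nra).
unfold Rdiv in *; rewrite Rmult_assoc.
set (w := (s * u + d) * / (s + d * u)) in *; split; nra.
Qed.

Lemma rho_0 (nu x y : R) :
  0 < nu -> rho nu x y 0 = tanh (sigma nu 0 * x) * tanh (sigma nu 0 * y).
Proof.
intros hnu; assert (hs := sigma_pos nu 0 hnu).
unfold rho; field; lra.
Qed.

(** The lower bound of [rho_bounds] increases with d through [sigma], and is attained at d = 0. *)
Lemma rho_ge_0 (nu x y d : R) :
  0 < nu -> 0 < x -> 0 < y -> 0 <= d -> rho nu x y 0 <= rho nu x y d.
Proof.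
intros hnu hx hy hd; rewrite rho_0 by exact hnu.
eapply Rle_trans; [|apply rho_bounds; auto].
assert (hs := sigma_pos nu 0 hnu); assert (hle := sigma_ge_0 nu d).
apply Rmult_le_compat; try (apply tanh_nonneg; nra);
  apply tanh_increasing; nra.
Qed.

Lemma rho_near_1 (nu x y c : R) :
  0 < nu -> 0 < x -> 0 < y -> c < 1 -> exists d, 0 <= d /\ c < rho nu x y d.
Proof.
intros hnu hx hy hc.
assert (hix := Rinv_0_lt_compat x hx); assert (hiy := Rinv_0_lt_compat y hy).
(* Chosen so that the deficits 1/(d x) and 1/(d y) of the two tanh values add up to (1 - c)/2. *)
pose (d := 2 * (/ x + / y) / (1 - c)).
assert (hd : 0 < d) by (apply Rdiv_lt_0_compat; lra).
exists d; split; [lra|].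
eapply Rlt_le_trans; [|apply rho_bounds; auto; lra].
assert (hsd := sigma_ge nu d hnu).
set (s := sigma nu d) in *.
assert (B : forall t, 0 < t -> 1 - / d * / t <= tanh (s * t)).
{ intros t ht.
  apply Rle_trans with (tanh (d * t)); [|apply tanh_increasing; nra].
  rewrite <- Rinv_mult; apply tanh_ge; nra. }
assert (Bx := B x hx); assert (By := B y hy).
assert (hx1 := tanh_lt_1 (s * x)); assert (hy1 := tanh_lt_1 (s * y)).
assert (hdd : / d * (/ x + / y) = (1 - c) / 2) by (unfold d; field; repeat split; nra).
(* Hence uv >= u + v - 1 >= (1 + c)/2 > c for the two tanh values u, v. *)
assert (0 <= (1 - tanh (s * x)) * (1 - tanh (s * y))) by nra.
nra.
Qed.

(** At the equilibrated [ts] the factor stays in [-v, v]; any other parameter exceeds v strictly,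
    which also gives uniqueness. *)
Lemma equilibrated_is_optimal (rho : R -> R) :
  0 <= rho 0 < 1 ->
  (forall d, 0 <= d -> rho 0 <= rho d <= 1) ->
  (forall c, c < 1 -> exists d, 0 <= d /\ c < rho d) ->
  is_optimal_relaxation (fun theta d => 1 - theta * (1 + rho d))
    (2 / (3 + rho 0)).
Proof.
intros h0 hb hlim.
set (r := fun theta d => 1 - theta * (1 + rho d)).
set (ts := 2 / (3 + rho 0)); set (v := (1 - rho 0) / (3 + rho 0)).
assert (hts : ts * (3 + rho 0) = 2) by (unfold ts; field; lra).
assert (hv : v = 2 * ts - 1) by (unfold v, ts; field; lra).
assert (hts01 : 0 < ts < 1).
{ split; nra. }
assert (hup : Rbar_le (sup_factor r ts) v).
{ apply Lub_Rbar_correct; intros x [d [hd ->]]; simpl.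
  assert (h := hb d hd); apply Rabs_le; unfold r; split; nra. }
assert (hlow : forall t, 0 < t < 1 -> t <> ts -> Rbar_lt v (sup_factor r t)).
{ intros t ht hne.
  assert (hex : exists d, 0 <= d /\ v < Rabs (r t d)).
  { destruct (Rlt_le_dec t ts) as [hlt | hge].
    - exists 0; split; [lra|].
      apply Rlt_le_trans with (2 := Rle_abs _); unfold r; nra.
    - assert (hlt : ts < t) by lra.
      (* The threshold is where the factor equals -v; it is below 1 since 1 + v = 2 ts < 2t. *)
      destruct (hlim ((1 + v) / t - 1)) as [d [hd hdc]].
      { assert ((1 + v) / t < 2) by (apply Rlt_div_l; lra); lra. }
      exists d; split; [exact hd|].
      rewrite <- Rabs_Ropp.
      apply Rlt_le_trans with (2 := Rle_abs _); unfold r.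
      assert (hq : (1 + v) / t < 1 + rho d) by lra.
      apply Rlt_div_l in hq; lra. }
  destruct hex as [d [hd hlt]].
  apply Rbar_lt_le_trans with (Rabs (r t d)); [exact hlt|].
  apply Lub_Rbar_correct; exists d; auto. }
split.
- split; [exact hts01|]; intros t ht.
  destruct (Req_dec t ts) as [-> | hne]; [apply Rbar_le_refl|].
  apply Rbar_le_trans with v; [exact hup|].
  apply Rbar_lt_le, hlow; assumption.
- intros t [ht hmin].
  destruct (Req_dec t ts) as [-> | hne]; [reflexivity|exfalso].
  apply (Rbar_lt_not_le (sup_factor r t) v); [apply hlow; assumption|].
  apply Rbar_le_trans with (sup_factor r ts); auto.
Qed.

Lemma factor_optimal (nu x y : R) :
  0 < nu -> 0 < x -> 0 < y ->
  is_optimal_relaxation (factor nu x y)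
    (2 / (3 + tanh (sigma nu 0 * x) * tanh (sigma nu 0 * y))).
Proof.
intros hnu hx hy; rewrite <- rho_0 by exact hnu.
apply equilibrated_is_optimal.
- rewrite rho_0 by exact hnu.
  assert (hs := sigma_pos nu 0 hnu).
  assert (hx1 := tanh_lt_1 (sigma nu 0 * x)).
  assert (hy1 := tanh_lt_1 (sigma nu 0 * y)).
  assert (0 <= tanh (sigma nu 0 * x)) by (apply tanh_nonneg; nra).
  assert (0 <= tanh (sigma nu 0 * y)) by (apply tanh_nonneg; nra).
  split; nra.
- intros d hd; split; [apply rho_ge_0 | apply rho_bounds]; auto.
- intros c hc; apply rho_near_1; auto.
Qed.

Theorem theorem10 (nu T alpha : R)
  (hnu : 0 < nu) (hT : 0 < T) (halpha : 0 < alpha < T) :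
  exists rDN3 rND2 : R -> R -> R,
    (forall theta d, 0 <= d ->
       is_factor (DN3_step nu T alpha theta d) (rDN3 theta d)) /\
    (forall theta d, 0 <= d ->
       is_factor (ND2_step nu T alpha theta d) (rND2 theta d)) /\
    exists theta : R,
      is_optimal_relaxation rDN3 theta /\ is_optimal_relaxation rND2 theta.
Proof.
exists (factor nu alpha (T - alpha)), (factor nu (T - alpha) alpha).
split; [|split].
- intros theta d hd; apply DN3_factor; assumption.
- intros theta d hd; apply ND2_factor; assumption.
- exists (2 / (3 + tanh (sigma nu 0 * alpha) * tanh (sigma nu 0 * (T - alpha)))).
  split; [apply factor_optimal; lra|].
  (* Exchanging [alpha] and [T - alpha] only swaps the two factors of the product. *)
  rewrite Rmult_comm with (r1 := tanh _).
  apply factor_optimal; lra.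
Qed.
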